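(* Let $A$ and $B$ be finite nontrivial groups with generating sets $X_A=A\setminus\{1_A\}$ and $X_B=B\setminus\{1_B\}$, and let $X:=X_A\cup X_B$, a generating set of the free product $A*B$. Then the spherical conjugacy growth series $\widetilde\sigma(A*B,X)$ is a rational function if and only if $A$ and $B$ are both isomorphic to $\mathbb Z/2\mathbb Z$. Moreover, given any total ordering of $X$ satisfying $a<b$ for all $a\in X_A$ and $b\in X_B$, for the induced shortlex ordering the associated spherical conjugacy language $\widetilde\Sigma(A*B,X)$ is a regular language if and only if $A$ and $B$ are both isomorphic to $\mathbb Z/2\mathbb Z$.
   Context: Let $G$ be a group with finite inverse-closed generating set $X$, and let $\pi:X^*\to G$ be the natural projection. Fix a total ordering of $X$ and let $<_{sl}$ be the induced shortlex ordering on $X^*$ (shorter words first; words of equal length compared lexicographically). For each conjugacy class $c$ of $G$, let $z_c$ be the $<_{sl}$-least word $w\in X^*$ with $\pi(w)\in c$. The spherical conjugacy language is $\widetilde\Sigma(G,X):=\{z_c : c\text{ a conjugacy class of }G\}$. The spherical conjugacy growth series is the power series $\widetilde\sigma(G,X)(z):=\sum_{i\ge0}|\{w\in\widetilde\Sigma(G,X): l(w)=i\}|\,z^i$, where $l(w)$ is word length; it does not depend on the ordering of $X$. A power series is rational if it is the expansion of a quotient of two polynomials. A language is regular if it is accepted by a finite state automaton. *)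

(* Defs.v *)
From HB Require Import structures.
From mathcomp Require Import all_boot all_order all_algebra all_fingroup.
From mathcomp Require Import finmap.
From mathcomp Require Import boolp classical_sets.

Set Implicit Arguments.
Unset Strict Implicit.
Unset Printing Implicit Defensive.

Local Open Scope group_scope.

(** The elements of A * B are the normal forms: words over the disjoint union
    of A and B without trivial letters, in which letters from A and letters
    from B alternate.  [free_product_universal] below checks the universal
    property. *)

Section FreeProduct.

Variables A B : groupType.

Implicit Types (x y : A + B) (u v w : seq (A + B)).

Definition fp_nontriv x :=
  match x with inl a => a != 1 | inr b => b != 1 end.

Definition fp_alternate x y :=
  match x, y with inl _, inr _ | inr _, inl _ => true | _, _ => false end.

Definition fp_normal w := all fp_nontriv w && sorted fp_alternate w.

Record free_product :=
  FreeProduct { fp_word : seq (A + B); fp_wordP : fp_normal fp_word }.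

HB.instance Definition _ := [isSub for fp_word].
HB.instance Definition _ := [Choice of free_product by <:].

Definition fp_push x w := if fp_nontriv x then x :: w else w.

(** The normal form of the product of a letter and a word in normal form. *)
Definition fp_cons x w :=
  match x, w with
  | inl a, inl a' :: w' => fp_push (inl (a * a')) w'
  | inr b, inr b' :: w' => fp_push (inr (b * b')) w'
  | _, _ => fp_push x w
  end.

Definition fp_letterV x : A + B :=
  match x with inl a => inl a^-1 | inr b => inr b^-1 end.

Lemma fp_nontrivV x : fp_nontriv (fp_letterV x) = fp_nontriv x.
Proof. by case: x => [a|b] /=; rewrite invg_eq1. Qed.

Lemma fp_normal_cons x w :
  fp_normal (x :: w) =
  [&& fp_nontriv x, fp_normal w & if w is y :: _ then fp_alternate x y else true].
Proof.
rewrite /fp_normal /=; case: w => [|y w] /=; rewrite ?andbT //.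
by rewrite -!andbA; do !bool_congr.
Qed.

Lemma fp_cons_normal x w : fp_normal w -> fp_normal (fp_cons x w).
Proof.
case: w => [|y w].
  by case: x => c _ /=; rewrite /fp_push; case: ifP => // ntc;
    rewrite fp_normal_cons ntc.
move=> nyw; have := nyw; rewrite fp_normal_cons => /and3P[nty nw alt].
case: x y nyw nty alt => [a|b] [a'|b'] nyw nty alt /=; rewrite /fp_push;
  case: ifP => // ntx; by rewrite fp_normal_cons ntx ?nyw ?nw /=.
Qed.

Lemma fp_consE x w : fp_normal (x :: w) -> fp_cons x w = x :: w.
Proof.
rewrite fp_normal_cons => /and3P[nt _ alt].
by case: x w nt alt => [a|b] [|[a'|b'] w] //= nt alt; rewrite /fp_push /= nt.
Qed.

Lemma fp_cons_inlM a a' w : fp_normal w ->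
  fp_cons (inl (a * a')) w = fp_cons (inl a) (fp_cons (inl a') w).
Proof.
have E1 v : (if v is inl _ :: _ then false else true) ->
    fp_cons (inl (a * a')) v = fp_cons (inl a) (fp_cons (inl a') v).
  case: v => [|[c|b] v] //= _; rewrite /fp_push /=;
    have [->|nt] /= := eqVneq a' 1; by rewrite ?mulg1.
case: w => [|[c|b] w] nw; [exact: E1| |exact: E1].
move: nw; rewrite fp_normal_cons => /and3P[ntc _ alt] /=.
rewrite /fp_push /= -mulgA; have [e|nt] /= := eqVneq (a' * c) 1.
  by rewrite e mulg1; case: w alt => [|[c'|b'] w].
by [].
Qed.

Lemma fp_cons_inrM b b' w : fp_normal w ->
  fp_cons (inr (b * b')) w = fp_cons (inr b) (fp_cons (inr b') w).
Proof.
have E1 v : (if v is inr _ :: _ then false else true) ->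
    fp_cons (inr (b * b')) v = fp_cons (inr b) (fp_cons (inr b') v).
  case: v => [|[a|c] v] //= _; rewrite /fp_push /=;
    have [->|nt] /= := eqVneq b' 1; by rewrite ?mulg1.
case: w => [|[a|c] w] nw; [exact: E1|exact: E1|].
move: nw; rewrite fp_normal_cons => /and3P[ntc _ alt] /=.
rewrite /fp_push /= -mulgA; have [e|nt] /= := eqVneq (b' * c) 1.
  by rewrite e mulg1; case: w alt => [|[a'|c'] w].
by [].
Qed.

Lemma fp_cons_triv x w : fp_normal w -> ~~ fp_nontriv x -> fp_cons x w = w.
Proof.
case: w => [|y w]; first by case: x => c /=; rewrite /fp_push /= => _ /negPf->.
rewrite fp_normal_cons => /and3P[nty _ _].
by case: x y nty => [a|b] [a'|b'] /= nty /negPn/eqP->;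
  rewrite /fp_push /= ?mul1g ?nty ?eqxx.
Qed.

Lemma fp_consV x w : fp_normal w -> fp_cons (fp_letterV x) (fp_cons x w) = w.
Proof.
move=> nw; case: x => [a|b]; rewrite [fp_letterV _]/=.
  by rewrite -fp_cons_inlM // mulVg fp_cons_triv //= eqxx.
by rewrite -fp_cons_inrM // mulVg fp_cons_triv //= eqxx.
Qed.

Lemma fp_mul_normal u v : fp_normal v -> fp_normal (foldr fp_cons v u).
Proof. by move=> nv; elim: u => //= x u IHu; apply: fp_cons_normal. Qed.

Lemma foldr_fp_cons x v w : fp_normal v -> fp_normal w ->
  foldr fp_cons w (fp_cons x v) = fp_cons x (foldr fp_cons w v).
Proof.
move=> nv nw; have push y u : fp_normal (foldr fp_cons w u) ->
    foldr fp_cons w (fp_push y u) = fp_cons y (foldr fp_cons w u).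
  rewrite /fp_push; case: ifP => // /negbT nty nu.
  by rewrite fp_cons_triv.
have nm u : fp_normal (foldr fp_cons w u) by apply: fp_mul_normal.
case: x v nv => [a|b] [|[a'|b'] v] _; try exact: push.
- by apply: etrans (push _ _ (nm v)) _; apply: fp_cons_inlM.
- by apply: etrans (push _ _ (nm v)) _; apply: fp_cons_inrM.
Qed.

Lemma fp_inv_normal w : fp_normal w -> fp_normal (rev (map fp_letterV w)).
Proof.
case/andP=> nt alt; rewrite /fp_normal all_rev all_map.
rewrite (eq_all (a2 := fp_nontriv)) ?nt; last by move=> x; apply: fp_nontrivV.
rewrite rev_sorted sorted_map; apply: sub_sorted alt.
by move=> [a|b] [a'|b'].
Qed.

Definition fp_one := @FreeProduct [::] isT.
Definition fp_mul (g h : free_product) :=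
  FreeProduct (fp_mul_normal (fp_word g) (fp_wordP h)).
Definition fp_inv (g : free_product) := FreeProduct (fp_inv_normal (fp_wordP g)).

Lemma fp_mulA : associative fp_mul.
Proof.
move=> [u nu] [v nv] [w nw]; apply: val_inj => /=.
elim: u nu => //= x u IHu; rewrite fp_normal_cons => /and3P[_ nu _].
by rewrite IHu // foldr_fp_cons // fp_mul_normal.
Qed.

Lemma fp_mul1g : left_id fp_one fp_mul.
Proof. by move=> g; apply: val_inj. Qed.

Lemma fp_mulg1 : right_id fp_one fp_mul.
Proof.
move=> [u nu]; apply: val_inj => /=; elim: u nu => //= x u IHu nxu.
by rewrite IHu ?fp_consE //; move: nxu; rewrite fp_normal_cons => /and3P[].
Qed.

Lemma fp_mulVg : left_inverse fp_one fp_inv fp_mul.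
Proof.
move=> [u nu]; apply: val_inj => /=; elim: u nu => //= x u IHu nxu.
have nu : fp_normal u by move: nxu; rewrite fp_normal_cons => /and3P[].
by rewrite rev_cons foldr_rcons -(fp_consE nxu) fp_consV ?IHu.
Qed.

Lemma fp_invK : involutive fp_inv.
Proof.
move=> [u nu]; apply: val_inj; rewrite /= map_rev revK -map_comp.
by apply: map_id_in => -[a|b] _ /=; rewrite invgK.
Qed.

Lemma fp_mulgV : right_inverse fp_one fp_inv fp_mul.
Proof. by move=> g; rewrite -{1}[g]fp_invK fp_mulVg. Qed.

HB.instance Definition _ := isGroup.Build free_product
  fp_mulA fp_mul1g fp_mulg1 fp_mulVg fp_mulgV.

Definition fp_inl (a : A) : free_product :=
  FreeProduct (fp_cons_normal (inl a) (w := [::]) isT).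
Definition fp_inr (b : B) : free_product :=
  FreeProduct (fp_cons_normal (inr b) (w := [::]) isT).

Definition fp_of_letter x : free_product :=
  match x with inl a => fp_inl a | inr b => fp_inr b end.

Lemma fp_of_letterM x (g : free_product) :
  fp_word (fp_of_letter x * g) = fp_cons x (fp_word g).
Proof.
by case: x => c; apply: foldr_fp_cons (isT : fp_normal [::]) (fp_wordP g).
Qed.

Lemma fp_inlM : {morph fp_inl : a a' / a * a'}.
Proof.
move=> a a'; apply: val_inj; apply: etrans (fp_cons_inlM a a' (w := [::]) isT) _.
by rewrite -[RHS]/(fp_word (fp_of_letter (inl a) * _)) fp_of_letterM.
Qed.

Lemma fp_inrM : {morph fp_inr : b b' / b * b'}.
Proof.
move=> b b'; apply: val_inj; apply: etrans (fp_cons_inrM b b' (w := [::]) isT) _.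
by rewrite -[RHS]/(fp_word (fp_of_letter (inr b) * _)) fp_of_letterM.
Qed.

Lemma fp_prod_letters (g : free_product) :
  g = \prod_(x <- fp_word g) fp_of_letter x.
Proof.
case: g => w nw; apply: val_inj; rewrite [LHS]/= [in RHS]/=.
elim: w nw => [|x w IHw] nxw; first by rewrite big_nil.
have := nxw; rewrite fp_normal_cons => /and3P[_ nw _].
by rewrite big_cons [RHS]fp_of_letterM -[fp_word _](IHw nw) fp_consE.
Qed.

Lemma free_product_universal (G : groupType) (f : A -> G) (g : B -> G) :
    {morph f : a a' / a * a'} -> {morph g : b b' / b * b'} ->
  exists! h : free_product -> G,
    [/\ {morph h : r s / r * s}, h \o fp_inl =1 f & h \o fp_inr =1 g].
Proof.
move=> fM gM.
have morph1 (H K : groupType) (k : H -> K) : {morph k : x y / x * y} -> k 1 = 1.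
  by move=> kM; apply: (mulgI (k 1)); rewrite -kM !mulg1.
pose phi x := match x with inl a => f a | inr b => g b end.
pose lift w := \prod_(x <- w) phi x.
have lift_push x w : lift (fp_push x w) = phi x * lift w.
  rewrite /fp_push; case: ifP => [_|/negbT]; first by rewrite /lift big_cons.
  by case: x => c /negPn/eqP->; rewrite /= morph1 ?mul1g.
have lift_cons x w : lift (fp_cons x w) = phi x * lift w.
  case: x w => [a|b] [|[a'|b'] w]; rewrite [fp_cons _ _]/= lift_push //.
    by rewrite /lift big_cons mulgA /= fM.
  by rewrite /lift big_cons mulgA /= gM.
have lift_mul u v : lift (foldr fp_cons v u) = lift u * lift v.
  elim: u => [|x u IHu] /=; first by rewrite /lift big_nil mul1g.
  by rewrite lift_cons IHu /lift big_cons mulgA.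
exists (fun r => lift (fp_word r)); split.
  split=> [r s|a|b]; first exact: lift_mul.
  - by rewrite [LHS](lift_cons (inl a) [::]) /lift big_nil mulg1.
  - by rewrite [LHS](lift_cons (inr b) [::]) /lift big_nil mulg1.
move=> h [hM hf hg]; apply/funext => u; rewrite {2}[u]fp_prod_letters.
rewrite (big_morph h hM (morph1 _ _ _ hM)); apply: eq_bigr => -[a|b] _ /=.
  by rewrite -hf.
by rewrite -hg.
Qed.

End FreeProduct.

Section ConjugacyLanguage.

Local Open Scope classical_set_scope.

Variables (G : groupType) (X : {fset G}).

Implicit Types (lt : rel X) (w : seq X) (c : set G).

Definition word_eval w : G := \prod_(x <- w) val x.

Definition conj_class (g : G) : set G := [set h | exists k : G, h = g ^ k].

Definition is_conj_class c := exists g, c = conj_class g.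

Definition strict_total_order (T : eqType) (lt : rel T) :=
  [/\ irreflexive lt, transitive lt & forall x y, [|| x == y, lt x y | lt y x]].

Fixpoint lex_lt lt u w :=
  match u, w with
  | x :: u', y :: w' => lt x y || ((x == y) && lex_lt lt u' w')
  | [::], _ :: _ => true
  | _, [::] => false
  end.

Definition shortlex lt u w :=
  (size u < size w)%N || ((size u == size w) && lex_lt lt u w).

(** [w] is the word z_c: the shortlex-least word representing an element of
    the conjugacy class [c]. *)
Definition class_rep lt c w :=
  c (word_eval w) /\
  forall u, c (word_eval u) -> u = w \/ shortlex lt w u.

Definition spherical_conj_language lt : set (seq X) :=
  [set w | exists2 c, is_conj_class c & class_rep lt c w].

End ConjugacyLanguage.

Definition growth (T : finType) (L : set (seq T)) (n : nat) : nat :=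
  #|[pred t : n.-tuple T | `[< L t >]]|.

Definition spherical_conj_growth_series (F : nzSemiRingType) (G : groupType)
    (X : {fset G}) (lt : rel X) (n : nat) : F :=
  (growth (spherical_conj_language lt) n)%:R%R.

(** A power series is given by its coefficient sequence.  It is the expansion
    of p / q, where q(0) != 0, when the Cauchy product of q with it is p. *)
Definition rational_series (F : fieldType) (f : nat -> F) :=
  (exists p q : {poly F}, q`_0 != 0 /\
    forall n, \sum_(i < n.+1) q`_i * f (n - i)%N = p`_n)%R.

Record automaton (T : finType) := Automaton {
  state : finType;
  initial : state;
  step : state -> T -> state;
  final : pred state
}.

Definition accepts (T : finType) (M : automaton T) (w : seq T) :=
  final (foldl (@step T M) (initial M) w).

Definition regular (T : finType) (L : set (seq T)) :=
  exists M : automaton T, forall w, L w <-> accepts M w.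

Section Generators.

Variables A B : finGroupType.

Local Open Scope fset_scope.

Definition gens_left : {fset free_product A B} :=
  [fset fp_inl B a | a in [set: A]^#].

Definition gens_right : {fset free_product A B} :=
  [fset fp_inr A b | b in [set: B]^#].

Definition fp_gens := gens_left `|` gens_right.

Lemma fp_gensV g : g \in fp_gens -> g^-1 \in fp_gens.
Proof.
have inV (C : finGroupType) (k : C -> free_product A B) :
    {morph k : c d / c * d} -> forall c, (k c)^-1 = k c^-1.
  move=> kM c; have k1 : k 1 = 1 by apply: (mulgI (k 1)); rewrite -kM !mulg1.
  by apply: (mulgI (k c)); rewrite mulgV -kM mulgV k1.
rewrite !in_fsetU => /orP[] /imfsetP[c /= nc ->]; apply/orP; [left|right].
  apply/imfsetP; exists c^-1; last exact/inV/fp_inlM.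
  by move: nc; rewrite !inE invg_eq1.
apply/imfsetP; exists c^-1; last exact/inV/fp_inrM.
by move: nc; rewrite !inE invg_eq1.
Qed.

Lemma fp_gens_generate (g : free_product A B) :
  exists w : seq fp_gens, word_eval w = g.
Proof.
rewrite [g]fp_prod_letters; have /andP[nt _] := fp_wordP g.
elim: (fp_word g) nt => [|x w IHw] /=; first by exists [::]; rewrite /word_eval !big_nil.
case/andP=> ntx /IHw[v Ev].
have gx : fp_of_letter x \in fp_gens.
  rewrite in_fsetU; case: x ntx => c ntc; apply/orP; [left|right];
    by apply/imfsetP; exists c => //=; rewrite !inE andbT.
by exists ([` gx] :: v); rewrite /word_eval !big_cons -Ev.
Qed.

End Generators.

(* Main.v *)
(** A nontrivial conjugacy class meeting neither factor is represented exactly by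
    the rotations of an alternating word of even length, so for k > 0 the
    coefficient c of z^(2k) counts the orbits of rotation on such words, and the
    higher odd coefficients vanish.  There are 2 N^k such words with
    N = (|A| - 1)(|B| - 1), and those with a nontrivial stabiliser are so few that
    k c = N^k + O(k^2 N^(k/2 + 1)).  If N > 1, a linear recurrence for c over the
    integers, multiplied by k (k - 1) ... (k - d), says that a fixed integer
    polynomial takes values of absolute value less than 1 at all large k; so it
    vanishes, whereas its value at 0 is nonzero.  A recurrence over the field of
    coefficients yields one over the integers by a linear algebra argument.
    Regular languages have rational growth; if N = 1, the words of length at least
    2 in the language are the (ab)^k. *)

Require Import Defs.
From HB Require Import structures.
From mathcomp Require Import all_boot all_order all_algebra all_fingroup.
From mathcomp Require Import finmap.
From mathcomp Require Import boolp classical_sets.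
From mathcomp Require Import cyclic zify ring.

Set Implicit Arguments.
Unset Strict Implicit.
Unset Printing Implicit Defensive.

(** * Linear recurrences and sequences close to [N ^ k / k] *)

Section Irrationality.

Import Order.TTheory GRing.Theory Num.Theory.

(** With [q = j %/ s.+1] one has [j <= s.+1 * q.+1 <= s.+1 * 2 ^ q], hence [j ^ s.+1 <= K * 2 ^ j];
    the extra factor [j] exceeds [C * K]. *)
Lemma expn_dominates (C s : nat) : exists j0, forall j, j0 <= j -> C * j ^ s < 2 ^ j.
Proof.
pose K := s.+1 ^ s.+1; exists (C * K).+1 => j lt_j.
have K_gt0 : 0 < K by rewrite expn_gt0.
have jK : j ^ s.+1 <= K * 2 ^ j.
  have q_lt : (j %/ s.+1).+1 <= 2 ^ (j %/ s.+1) by apply: ltn_expl.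
  have j_le : j <= s.+1 * (j %/ s.+1).+1.
    by rewrite mulnC ltnW // ltn_ceil.
  apply: (leq_trans (_ : _ <= (s.+1 * (j %/ s.+1).+1) ^ s.+1)); first by rewrite leq_exp2r.
  rewrite expnMn leq_mul2l; apply/orP; right.
  apply: leq_trans (_ : (2 ^ (j %/ s.+1)) ^ s.+1 <= _); first by rewrite leq_exp2r.
  by rewrite -expnM leq_exp2l // leq_trunc_div.
have j_gt0 : 0 < j by apply: leq_trans lt_j.
rewrite -(ltn_pmul2l K_gt0); apply: leq_trans jK.
by rewrite mulnA (mulnC K) expnS ltn_mul2r expn_gt0 j_gt0.
Qed.

Local Open Scope ring_scope.

(** In other words, some linear form over the rationals on the span of the [q i] takes integer
    values on them and is nonzero at [q 0]. It is extended one [q i] at a time: by zero if no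
    integer relation involves the new element, and otherwise as a relation dictates, after
    scaling. *)
Lemma int_relations (F : numFieldType) (q : nat -> F) (d : nat) : q 0%N != 0 ->
  exists2 r : nat -> int, r 0%N != 0 &
    forall c : nat -> int, \sum_(i < d.+1) (c i)%:~R * q i = 0 ->
      \sum_(i < d.+1) c i * r i = 0.
Proof.
move=> q0; elim: d => [|d [r r0 rel_r]].
  exists (fun _ => 1) => // c; rewrite !big_ord1 => /eqP.
  by rewrite mulf_eq0 (negPf q0) orbF intr_eq0 => /eqP->; rewrite mul0r.
have [[s [s_nz rel_s]]|indep] := pselect (exists s : nat -> int,
    s d.+1 != 0 /\ \sum_(i < d.+2) (s i)%:~R * q i = 0); last first.
  exists (fun i => if (i <= d)%N then r i else 0) => // c rel_c.
  have c0 : c d.+1 = 0.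
    by apply/eqP; apply: contrapT => /negP c_nz; apply: indep; exists c.
  rewrite big_ord_recr /= c0 mul0r addr0.
  rewrite -[RHS](rel_r c); last by move: rel_c; rewrite big_ord_recr /= c0 mul0r addr0.
  by apply: eq_bigr => i _; rewrite -ltnS ltn_ord.
(* The relation [s] forces the new value; scaling by [- s d.+1] clears its denominator. *)
exists (fun i => if (i <= d)%N then - s d.+1 * r i else \sum_(j < d.+1) s j * r j).
  by rewrite leq0n mulNr oppr_eq0 mulf_neq0.
move=> c rel_c.
rewrite big_ord_recr /= ltnn.
(* Eliminating [q d.+1] between [c] and [s] leaves a relation among the earlier elements. *)
pose c' i := s d.+1 * c i - c d.+1 * s i.
have /(rel_r c') rel : \sum_(i < d.+1) (c' i)%:~R * q i = 0.
  transitivity ((s d.+1)%:~R * \sum_(i < d.+2) (c i)%:~R * q i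
                - (c d.+1)%:~R * \sum_(i < d.+2) (s i)%:~R * q i); last first.
    by rewrite rel_c rel_s !mulr0 subr0.
  rewrite ![\sum_(i < d.+2) _]big_ord_recr /= !mulrDr !mulr_sumr.
  rewrite opprD addrACA -sumrB [X in _ = _ + X](_ : _ = 0); last by ring.
  by rewrite addr0; apply: eq_bigr => i _; rewrite /c' intrD intrN !intrM; ring.
apply: etrans (_ : - \sum_(i < d.+1) c' i * r i = 0); last by rewrite rel oppr0.
rewrite mulr_sumr -big_split /= -sumrN.
apply: eq_bigr => i _; rewrite /c' -ltnS ltn_ord; ring.
Qed.

Lemma PoszX (m k : nat) : (m ^ k)%N%:Z = m%:Z ^+ k.
Proof. by elim: k => // k IHk; rewrite expnS exprS PoszM IHk. Qed.

Lemma no_recurrence (a : nat -> nat) (N K d : nat) (r : nat -> int) :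
    (1 < N)%N -> r 0%N != 0 ->
    (forall k, (0 < k)%N -> (N ^ k <= k * a k <= N ^ k + 4 * k ^ 2 * N ^ (k./2).+1)%N) ->
    (forall k, (K <= k)%N -> \sum_(j < d.+1) r j * (a (k - j)%N)%:Z = 0) ->
  False.
Proof.
move=> N_gt1 r0 a_bound rec_a.
(* The recurrence at [k] is multiplied by the product of all [k - i]; [W k j] is what remains once
   [k - j] is spent on [a (k - j)]. *)
pose W (k : nat) (j : 'I_d.+1) : int := \prod_(i < d.+1 | i != j) (k%:Z - i%:Z).
(* [P] collects the main terms [N ^ (k - j)] after division by [N ^ (k - d)], so its coefficients
   are integers. *)
pose P : {poly int} :=
  \sum_(j < d.+1) (r j * N%:Z ^+ (d - j))%:P * \prod_(i < d.+1 | i != j) ('X - (i%:Z)%:P).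
have PE k : P.[k%:Z] = \sum_(j < d.+1) r j * N%:Z ^+ (d - j) * W k j.
  rewrite horner_sum; apply: eq_bigr => j _; rewrite hornerM hornerC horner_prod.
  by congr (_ * _); apply: eq_bigr => i _; rewrite hornerXsubC.
(* At 0 every summand with [j] nonzero has the vanishing factor for [i = 0]. *)
have P0 : P.[0] != 0.
  rewrite (PE 0%N) (bigD1 ord0) //= big1 => [|j j_nz].
    rewrite addr0 !mulf_neq0 ?expf_neq0 //; first by lia.
    by apply/prodf_neq0 => i i_nz; rewrite sub0r oppr_eq0; apply: contraNneq i_nz => /eqP.
  by rewrite /W (bigD1 ord0) 1?eq_sym //= subrr mul0r mulr0.
pose e k : int := (k * a k)%:Z - (N ^ k)%:Z.
have e_bound k : (0 < k)%N -> `|e k| <= (4 * k ^ 2 * N ^ (k./2).+1)%:Z.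
  by move=> /a_bound; rewrite /e; set u := (k * a k)%N; set v := (N ^ k)%N; lia.
have key k : (K <= k)%N -> (d < k)%N ->
    N%:Z ^+ (k - d) * P.[k%:Z] = - \sum_(j < d.+1) r j * W k j * e (k - j)%N.
  move=> leKk lt_dk; apply/eqP; rewrite -addr_eq0 PE mulr_sumr -big_split /=.
  transitivity (\prod_(i < d.+1) (k%:Z - i%:Z) * \sum_(j < d.+1) r j * (a (k - j)%N)%:Z == 0).
    congr (_ == _); rewrite mulr_sumr; apply: eq_bigr => j _.
    have j_le : (j <= d)%N by rewrite -ltnS.
    rewrite (bigD1 j) //= -/(W k j) /e PoszM -subzn; last lia.
    have -> : (N ^ (k - j))%N%:Z = N%:Z ^+ (k - d) * N%:Z ^+ (d - j).
      by rewrite PoszX -exprD; congr (_ ^+ _); lia.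
    by ring.
  by rewrite rec_a // mulr0.
pose R : nat := (\sum_(j < d.+1) `|r j|)%N.
have bound k : (K <= k)%N -> (d < k)%N ->
    (`|(N%:Z ^+ (k - d) * P.[k%:Z])%R| <= R * k ^ d.+1 * (4 * k ^ 2 * N ^ (k./2).+1))%N.
  move=> leKk lt_dk; rewrite key // -lez_nat abszE normrN.
  apply: le_trans (ler_norm_sum _ _ _) _.
  rewrite /R -mulnA !PoszM rmorph_sum /= mulr_suml; apply: ler_sum => j _.
  have j_le : (j <= d)%N by rewrite -ltnS.
  rewrite !normrM -mulrA -abszE ler_wpM2l // ler_pM //.
    rewrite /W normr_prod big_mkcond /=.
    have -> : (k ^ d.+1)%N%:Z = \prod_(i < d.+1) k%:Z.
      by rewrite prodr_const card_ord PoszX.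
    by apply: ler_prod => i _; case: ifP => _; rewrite ?normr_ge0 ?ler01; have := ltn_ord i; lia.
  apply: le_trans (e_bound _ _) _; first lia.
  by rewrite lez_nat !leq_mul ?leq_pexp2l ?leq_exp2r //; lia.
(* If [P] is nonzero at [k], then [bound], multiplied by [N ^ d] and divided by [N ^ k./2], gives
   [N ^ h <= C * h ^ s] for [h = uphalf k]: the exponents [d.+1] and [2] add up to [s], and
   [k <= 2 * h] accounts for [2 ^ s]. *)
pose s := (d + 3)%N; pose C := (R * 4 * N ^ d.+1 * 2 ^ s)%N.
have [h0 exp_gt] := expn_dominates C s.
have root_P k : (K + d + h0 * 2 < k)%N -> root P k%:Z.
  move=> k_gt; apply: contraT => Pk_nz.
  have := bound k; rewrite abszM abszX => le_k.
  have {}le_k := le_k ltac:(lia) ltac:(lia).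
  have P_ge1 : (1 <= `|P.[k%:Z]|)%N by rewrite absz_gt0.
  have k_split : (k = uphalf k + k./2)%N by rewrite uphalf_half; have := odd_double_half k; lia.
  have hk : (k <= 2 * uphalf k)%N by rewrite uphalf_half; have := odd_double_half k; lia.
  have := exp_gt (uphalf k) ltac:(lia); rewrite ltnNge => /negP[].
  apply: leq_trans (_ : N ^ uphalf k <= _)%N; first by rewrite leq_exp2r //; lia.
  rewrite -(@leq_pmul2r (N ^ k./2)) ?expn_gt0 ?(ltnW N_gt1) // -expnD -k_split.
  rewrite -(subnK (_ : d <= k)%N); last lia.
  rewrite expnD.
  apply: leq_trans (leq_mul (_ : _ <= R * k ^ d.+1 * (4 * k ^ 2 * N ^ (k./2).+1))%N (leqnn _)) _.
    by apply: leq_trans le_k; rewrite leq_pmulr.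
  rewrite subnK; last lia.
  apply: leq_trans (_ : R * 4 * N ^ d.+1 * k ^ s * N ^ k./2 <= _)%N.
    by rewrite /s addn3 !expnS; apply: eq_leq; ring.
  rewrite leq_mul2r; apply/orP; right.
  by rewrite /C -[leqRHS]mulnA leq_mul2l -expnMn leq_exp2r ?hk ?orbT // /s addn3.
have P_nz : P != 0 by apply: contraNneq P0 => ->; rewrite horner0.
(* One root more than the degree of [P] allows. *)
pose rs := [seq (K + d + h0 * 2 + i.+1)%N%:Z | i <- iota 0 (size P)].
have rs_roots : all (root P) rs.
  by apply/allP => x /mapP[i _ ->]; apply: root_P; lia.
have rs_uniq : uniq rs.
  by rewrite map_inj_uniq ?iota_uniq // => i j /eqP; rewrite eqz_nat; lia.
by have := max_poly_roots P_nz rs_roots rs_uniq; rewrite size_map size_iota ltnn.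
Qed.

(** In the Cauchy product at [2 k], for large [k], the terms with an odd index drop out, so the even
    coefficients of the denominator give a recurrence for [f] at even indices; [int_relations] makes
    it integral. *)
Lemma irrational_growth (F : numFieldType) (f : nat -> nat) (N : nat) : (1 < N)%N ->
    (forall k, (0 < k)%N ->
      (N ^ k <= k * f k.*2 <= N ^ k + 4 * k ^ 2 * N ^ (k./2).+1)%N) ->
    (forall n, odd n -> (2 < n)%N -> f n = 0%N) ->
  ~ rational_series (fun n => (f n)%:R : F).
Proof.
move=> N_gt1 f_bound f_odd [p [q [q0 rat_f]]].
pose d := size q.
have [r r0 rel_r] := @int_relations F (fun j => q`_(j.*2)) d q0.
apply: (@no_recurrence (fun k => f k.*2) N (size p + d + 1)%N d r) => // k k_ge.
rewrite -[RHS](rel_r (fun j => (f (k - j).*2)%:Z)); first by apply: eq_bigr => j _; rewrite mulrC.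
have [p_le d_lt] : (size p <= k)%N /\ (d < k)%N.
  by move: k_ge; set u := size p; set v := d; lia.
have := rat_f k.*2; rewrite [p`_ _]nth_default => [rec_k|]; last first.
  by apply: leq_trans p_le _; rewrite -addnn leq_addr.
have sum_even (g : nat -> F) m : (forall i, (i < m)%N -> g i.*2.+1 = 0) ->
    \sum_(i < m.*2.+1) g i = \sum_(j < m.+1) g j.*2.
  elim: m => [|m IHm] g_odd; first by rewrite !big_ord1.
  by rewrite doubleS 2!big_ord_recr /= g_odd // addr0 IHm ?[RHS]big_ord_recr // => i /ltnW/g_odd.
apply: etrans rec_k; rewrite (sum_even (fun i => q`_i * (f (k.*2 - i)%N)%:R)) => [|i lt_ik].
  have le_dk : (d.+1 <= k.+1)%N by lia.
  rewrite (big_ord_widen _ (fun j => (f (k - j).*2)%:Z%:~R * q`_(j.*2)) le_dk) big_mkcond /=.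
  apply: eq_bigr => j _; rewrite doubleB mulrC; case: ifP => // /negbT j_gt.
  have d_le : (d <= j)%N by move: j_gt; rewrite -leqNgt => /ltnW.
  rewrite [q`_ _]nth_default ?mulr0 ?mul0r //.
  by apply: leq_trans d_le _; rewrite -addnn leq_addr.
(* The value [f 1] may be nonzero: below [d] the argument of [f] is odd and exceeds 2, and from [d]
   on the coefficient of [q] vanishes. *)
have [i_lt|i_ge] := ltnP i.*2.+1 d; last by rewrite nth_default ?mul0r.
rewrite f_odd ?mulr0 //; last by move: i_lt d_lt; rewrite -!addnn; move: (d) => D; lia.
by rewrite oddB ?oddS ?odd_double //; rewrite -!addnn; lia.
Qed.

End Irrationality.

(** * The lexicographic order, total on words of equal length *)

Section Lex.

Variables (G : groupType) (T : {fset G}) (lt : rel T).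
Hypothesis lt_order : strict_total_order lt.

Lemma lex_lt_irr : irreflexive (lex_lt lt).
Proof. by case: lt_order => irr _ _; elim=> //= x u ->; rewrite irr andbF. Qed.

Lemma lex_lt_trans : transitive (lex_lt lt).
Proof.
case: lt_order => _ tr _; elim=> [|y v IHv] [|x u] [|z w] //=.
case/orP=> [xy|/andP[/eqP<- uv]] /orP[yz|/andP[/eqP<- vw]].
- by rewrite (tr y).
- by rewrite xy.
- by rewrite yz.
- by rewrite eqxx (IHv u w) ?orbT.
Qed.

Lemma lex_lt_total u v : size u = size v -> [|| u == v, lex_lt lt u v | lex_lt lt v u].
Proof.
case: lt_order => irr _ tot; elim: u v => [|x u IHu] [|y v] //= [/IHu].
rewrite eqseq_cons (eq_sym y x); case: (eqVneq x y) (tot x y) => [->|_] /=.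
  by rewrite irr.
by case/orP=> ->; rewrite ?orbT.
Qed.

End Lex.

(** * Least rotations of a word *)

Section Rotations.

Variables (T : eqType) (lex : rel (seq T)).

(** Equality is allowed because a periodic word coincides with some of its proper rotations; shifts
    from [size w] on act trivially. *)
Definition least_rotation (w : seq T) :=
  all (fun i => (rot i w == w) || lex w (rot i w)) (iota 0 (size w)).

Lemma least_rotationP (w : seq T) :
  reflect (forall i, (rot i w == w) || lex w (rot i w)) (least_rotation w).
Proof.
apply: (iffP allP) => [least i|least i _]; last exact: least.
have [lt_i|ge_i] := ltnP i (size w); first by apply: least; rewrite mem_iota.
by rewrite rot_oversize ?eqxx.
Qed.

Lemma rot_invE i (w : seq T) : exists j, rot j (rot i w) = w.
Proof. by exists (size w - i); have := rotK i w; rewrite /rotr size_rot. Qed.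

(** A word fixed by [rot i] has period [i], so its first [i] letters determine it. *)
Lemma eq_rot_fixed (t u : seq T) i k : 0 < i <= k -> size t = size u ->
  rot i t = t -> rot i u = u -> take k t = take k u -> t = u.
Proof.
case/andP=> i_gt0 le_ik eq_sz fix_t fix_u eq_take.
case: t eq_sz fix_t eq_take => [|x0 t'] eq_sz; first by case: u eq_sz {fix_u}.
move: (x0 :: t') eq_sz => t eq_sz fix_t eq_take.
have period (s : seq T) j : rot i s = s -> i + j < size s -> nth x0 s (i + j) = nth x0 s j.
  move=> fix_s lt_ij; rewrite -{2}fix_s /rot nth_cat size_drop nth_drop ifT //; lia.
apply: (@eq_from_nth _ x0) => // j; elim/ltn_ind: j => j IHj lt_j.
have [lt_jk|le_kj] := ltnP j k; first by rewrite -(nth_take _ lt_jk) eq_take nth_take.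
have Dj : j = i + (j - i) by lia.
by rewrite Dj !period -?Dj -?eq_sz // IHj //; lia.
Qed.

Hypothesis lex_irr : irreflexive lex.
Hypothesis lex_trans : transitive lex.
Hypothesis lex_total :
  forall u v, size u = size v -> [|| u == v, lex u v | lex v u].

Lemma lex_least_exists (n : nat) (s : seq (seq T)) :
    s != [::] -> all (fun u => size u == n) s ->
  exists2 m, m \in s & all (fun u => (u == m) || lex m u) s.
Proof.
elim: s => // u [|v s] IHs _ /= /andP[/eqP szu szs].
  by exists u; rewrite ?mem_head //= eqxx.
have [m m_in least_m] := IHs isT szs.
have /eqP szm := allP (szs : all (fun u => size u == n) (v :: s)) m m_in.
have /or3P[/eqP eq_um|lt_um|lt_mu] := lex_total (etrans szu (esym szm)).
- by exists m; rewrite ?inE ?eq_um ?eqxx // m_in orbT.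
- exists u; rewrite ?mem_head //= eqxx /=.
  apply: sub_all least_m => w /orP[/eqP->|lt_mw]; first by rewrite lt_um orbT.
  by rewrite (lex_trans lt_um lt_mw) orbT.
- by exists m; [rewrite in_cons m_in orbT | rewrite /= lt_mu orbT].
Qed.

Lemma least_rotation_exists (w : seq T) : exists i, least_rotation (rot i w).
Proof.
have [->|w_nz] := eqVneq w [::]; first by exists 0.
pose s := [seq rot i w | i <- iota 0 (size w)].
have rot_in k : rot k w \in s.
  have [lt_k|ge_k] := ltnP k (size w); first by apply/mapP; exists k; rewrite ?mem_iota.
  by apply/mapP; exists 0; rewrite ?rot0 ?rot_oversize // mem_iota lt0n size_eq0.
have [||m m_in least_m] := @lex_least_exists (size w) s.
- by rewrite -size_eq0 size_map size_iota size_eq0.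
- by apply/allP => _ /mapP[i _ ->]; rewrite size_rot.
have {m_in}[i lt_i Dm] := mapP m_in; exists i; rewrite -Dm.
apply/least_rotationP => j; rewrite [rot j m](_ : _ = rot (rot_add w i j) w).
  exact: (allP least_m).
by rewrite Dm rot_rot_add.
Qed.

(** If the two words differed, each would be strictly below the other. *)
Lemma least_rotation_unique i (w : seq T) :
  least_rotation w -> least_rotation (rot i w) -> rot i w = w.
Proof.
move=> /least_rotationP/(_ i)/orP[/eqP//|lt_w] /least_rotationP least_rw.
have [j Dw] := rot_invE i w; have := least_rw j; rewrite Dw => /orP[/eqP/esym//|gt_w].
by have := lex_trans lt_w gt_w; rewrite lex_irr.
Qed.

End Rotations.

(** * Counting cyclically alternating words up to rotation *)

Section Necklaces.

Variables (X : finType) (ty : pred X) (lex : rel (seq X)).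
Hypothesis lex_irr : irreflexive lex.
Hypothesis lex_trans : transitive lex.
Hypothesis lex_total :
  forall u v, size u = size v -> [|| u == v, lex u v | lex v u].

Definition switch : rel X := fun x y => ty x != ty y.

Fixpoint alternating (b : bool) (w : seq X) :=
  if w is x :: w' then (ty x == b) && alternating (~~ b) w' else true.

Lemma path_alternating x w : path switch x w = alternating (~~ ty x) w.
Proof.
elim: w x => //= y w IHw x; rewrite IHw /switch eq_sym.
by case: (ty x) (ty y) => -[].
Qed.

Lemma cycle_alternating w : path.cycle switch w =
  ~~ odd (size w) && (alternating true w || alternating false w).
Proof.
case: w => //= x w; rewrite path_alternating negbK.
have -> b y : alternating b (rcons w y) = alternating b w && (ty y == b (+) odd (size w)).
  elim: w b => /= [|z w IHw] b; first by rewrite andbT addbF.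
  by rewrite IHw andbA addNb addbN.
by case: (ty x) (odd _) => -[] /=; rewrite ?andbT ?andbF ?orbF.
Qed.

(** These are the words themselves; the rotation orbits are counted by [necklace_reps], which holds
    the least word of each. *)
Definition necklaces n := [set t : n.-tuple X | path.cycle switch t].
Definition necklace_reps n :=
  [set t : n.-tuple X | path.cycle switch t && least_rotation lex t].
Definition rot_fixed n i := [set t : n.-tuple X | path.cycle switch t & rot i t == t].

(** Every such word is a rotation, by less than [n], of a least one. *)
Lemma card_necklaces_le n : 0 < n -> #|necklaces n| <= n * #|necklace_reps n|.
Proof.
case: n => // n _.
have -> : n.+1 * #|necklace_reps n.+1| =
    #|finset.setX (necklace_reps n.+1) [set: 'I_n.+1]|.
  by rewrite cardsX cardsT card_ord mulnC.
pose f (p : n.+1.-tuple X * 'I_n.+1) := [tuple of rot p.2 p.1].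
apply: leq_trans (leq_imset_card f _).
apply: subset_leq_card; apply/fintype.subsetP => t; rewrite inE => cyc_t.
have [i least_i] := least_rotation_exists lex_trans lex_total t.
have [j Dt] := rot_invE i t.
have [k [lt_k Dk]] : exists k, k < n.+1 /\ rot j (rot i t) = rot k (rot i t).
  have [lt_j|ge_j] := ltnP j n.+1; first by exists j.
  by exists 0; rewrite rot0 rot_oversize // size_rot size_tuple.
apply/imsetP; exists ([tuple of rot i t], Ordinal lt_k); last first.
  by apply: val_inj; rewrite /= -Dk Dt.
by rewrite !inE /= rot_cycle cyc_t least_i.
Qed.

(** Representatives with trivial stabiliser have [n] distinct rotations each, in disjoint orbits.
    Every other representative is fixed by some proper rotation, and a union bound counts these. *)
Lemma card_necklaces_ge n :
  n * #|necklace_reps n| <= #|necklaces n| + n * \sum_(i < n | 0 < i) #|rot_fixed n i|.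
Proof.
case: n => // n.
pose prim := [set t : n.+1.-tuple X | [forall i : 'I_n.+1, (0 < i) ==> (rot i t != t)]].
rewrite -(cardsID prim (necklace_reps _)) mulnDr leq_add //.
  have -> : n.+1 * #|necklace_reps n.+1 :&: prim| =
      #|finset.setX (necklace_reps n.+1 :&: prim) [set: 'I_n.+1]|.
    by rewrite cardsX cardsT card_ord mulnC.
  pose f (p : n.+1.-tuple X * 'I_n.+1) := [tuple of rot p.2 p.1].
  rewrite -(card_in_imset (f := f)) => [|[t i] [u j]]; last first.
    rewrite !inE !andbT /= => /andP[/andP[_ least_t] prim_t] /andP[/andP[_ least_u] _].
    move=> /(congr1 val) /= eq_rot.
    have [k Dt] := rot_invE i t.
    have eq_tu : t = u.
      have Dl : rot k (rot j u) = rot (rot_add u j k) u by rewrite rot_rot_add.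
      apply: val_inj; rewrite /= -[LHS]Dt eq_rot Dl.
      by apply: (least_rotation_unique lex_irr lex_trans least_u); rewrite -Dl -eq_rot Dt.
    congr (_, _) => //; rewrite -{u least_u}eq_tu in eq_rot.
    (* Equal rotations by [a < b] would make the rotation by [b - a] fix [t]. *)
    have no_rot (a b : 'I_n.+1) : a < b -> rot a t != rot b t.
      move=> lt_ab; apply: contraTneq prim_t => eq_ab; rewrite negb_forall.
      have lt_ba : b - a < n.+1 by rewrite (leq_ltn_trans (leq_subr _ _)).
      apply/existsP; exists (Ordinal lt_ba); rewrite negb_imply subn_gt0 lt_ab negbK /=.
      apply/eqP/(@rot_inj a); rewrite -rotD subnKC ?(ltnW lt_ab) ?eq_ab //.
      by rewrite size_tuple ltnW.
    apply: val_inj; have [lt_ij|lt_ji|//] := ltngtP i j.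
      by have := no_rot _ _ lt_ij; rewrite eq_rot eqxx.
    by have := no_rot _ _ lt_ji; rewrite eq_rot eqxx.
  apply: subset_leq_card; apply/fintype.subsetP => _ /imsetP[[t i] ti_in ->].
  by move: ti_in; rewrite !inE andbT /= => /andP[/andP[cyc_t _] _]; rewrite rot_cycle.
rewrite leq_mul2l; apply/orP; right.
apply: leq_trans (_ : #|\bigcup_(i < n.+1 | 0 < i) rot_fixed n.+1 i| <= _).
  apply: subset_leq_card; apply/fintype.subsetP => t; rewrite !inE negb_forall.
  case/andP=> /existsP[i]; rewrite negb_imply negbK => /andP[i_gt0 fix_i] /andP[cyc_t _].
  by apply/finset.bigcupP; exists i => //; rewrite inE cyc_t.
elim/big_ind2: _ => [|A a B b leA leB|i _]; rewrite ?cards0 //.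
by rewrite (leq_trans (leq_card_setU _ _).1) ?leq_add.
Qed.

Variables (N : nat).
Hypothesis card_ty : #|[pred x | ty x]| * #|[pred x | ~~ ty x]| = N.

Lemma card_alternatingS b n :
  #|[set t : n.+1.-tuple X | alternating b t]| =
  #|[pred x | ty x == b]| * #|[set t : n.-tuple X | alternating (~~ b) t]|.
Proof.
rewrite -cardX -[LHS](card_imset _ (f := fun t => (thead t, [tuple of behead t]))).
  apply: eq_card => -[x t]; rewrite !inE /=; apply/imsetP/andP.
    by case=> u; rewrite inE; case/tupleP: u => y u /= /andP[ty_y alt_u] [-> ->]; rewrite !theadE.
  case=> ty_x alt_t; exists [tuple of x :: t]; rewrite ?inE /= ?ty_x //.
  by congr (_, _); apply: val_inj.
move=> /= t u; case/tupleP: t => x t; case/tupleP: u => y u.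
by rewrite !theadE => -[-> eq_tu]; apply: val_inj; rewrite /= eq_tu.
Qed.

Lemma card_type_mul b : #|[pred x | ty x == b]| * #|[pred x | ty x == ~~ b]| = N.
Proof.
have cardT : #|[pred x | ty x == true]| = #|[pred x | ty x]|.
  by apply: eq_card => x; rewrite !inE eqb_id.
have cardF : #|[pred x | ty x == false]| = #|[pred x | ~~ ty x]|.
  by apply: eq_card => x; rewrite !inE eqbF_neg.
by rewrite -card_ty; case: b; rewrite cardT cardF // mulnC.
Qed.

Lemma card_alternating_double b k :
  #|[set t : k.*2.-tuple X | alternating b t]| = N ^ k.
Proof.
elim: k => [|k IHk].
  by rewrite (eq_card (B := predT)) ?card_tuple // => t; rewrite !inE tuple0.
by rewrite doubleS !card_alternatingS negbK mulnA card_type_mul IHk expnS.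
Qed.

(** Pairs of letters contribute [N ^ k./2]. For odd [k] one letter is left over; its type has at
    most [N] letters, since the other type is inhabited when [0 < N]. *)
Lemma card_alternating_le b k : 0 < N ->
  #|[set t : k.-tuple X | alternating b t]| <= N ^ k./2.+1.
Proof.
move=> N_gt0.
suff [j [-> le_j]] : exists j, #|[set t : k.-tuple X | alternating b t]| = j * N ^ k./2 /\ j <= N.
  by rewrite expnS leq_mul.
case odd_k: (odd k); have := odd_double_half k; rewrite odd_k.
  rewrite add1n; case: _ /; rewrite /= uphalf_double.
  exists #|[pred x | ty x == b]|; rewrite card_alternatingS card_alternating_double.
  split=> //; rewrite -(card_type_mul b) leq_pmulr //.
  by move: N_gt0; rewrite -(card_type_mul b) muln_gt0 => /andP[].
rewrite add0n; case: _ /; exists 1; rewrite doubleK.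
by rewrite mul1n card_alternating_double.
Qed.

Lemma necklaces_split k : ~~ odd k ->
  necklaces k = [set t : k.-tuple X | alternating true t] :|:
                [set t : k.-tuple X | alternating false t].
Proof. by move=> even_k; apply/setP => t; rewrite !inE cycle_alternating size_tuple even_k. Qed.

(** The type of the first letter separates the two alternating kinds once words are nonempty. *)
Lemma card_necklaces_double k : 0 < k -> #|necklaces k.*2| = 2 * N ^ k.
Proof.
move=> k_gt0; rewrite necklaces_split ?odd_double //.
rewrite cardsU !card_alternating_double eq_card0 ?subn0 ?addnn ?mul2n // => t.
case: k k_gt0 t => // k _ [[|x w] //= sz_w]; rewrite !inE /=.
by case: (ty x); rewrite /= ?andbF.
Qed.

Lemma card_necklace_reps_odd n : odd n -> #|necklace_reps n| = 0.
Proof.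
by move=> odd_n; apply: eq_card0 => t; rewrite !inE cycle_alternating size_tuple odd_n.
Qed.

(** For [i <= k] a fixed word is determined by its first [k] letters, which alternate and begin with
    either type. *)
Lemma card_rot_fixed k i : 0 < N -> 0 < i < k.*2 ->
  #|rot_fixed k.*2 i| <= 2 * N ^ k./2.+1.
Proof.
move=> N_gt0.
(* Rotation by [k.*2 - i] is inverse to rotation by [i], so both fix the same words. *)
wlog le_ik : i / i <= k.
  move=> main i_lt; have [/main->//|lt_ki] := leqP i k.
  rewrite (eq_card (B := rot_fixed k.*2 (k.*2 - i))).
    by apply: main; rewrite -!addnn in i_lt *; lia.
  move=> t; rewrite !inE; congr (_ && _).
  have := rotK i t; have := rotrK i t; rewrite /rotr size_rot size_tuple => tK Kt.
  by apply/eqP/eqP => Dt; [rewrite -{1}Dt Kt | rewrite -{1}Dt tK].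
case/andP=> i_gt0 _.
have le_k2 : k <= k.*2 by rewrite -addnn leq_addr.
have size_take_k (t : k.*2.-tuple X) : size (take k t) == k.
  by rewrite size_take_min size_tuple; apply/eqP/minn_idPl.
pose f (t : k.*2.-tuple X) : k.-tuple X := Tuple (size_take_k t).
rewrite -(card_in_imset (f := f)) => [|t u]; last first.
  rewrite !inE => /andP[_ /eqP fix_t] /andP[_ /eqP fix_u] /(congr1 val)/= eq_take.
  apply: val_inj; apply: (eq_rot_fixed _ _ fix_t fix_u eq_take); rewrite ?i_gt0 //.
  by rewrite !size_tuple.
apply: leq_trans (_ : #|[set t : k.-tuple X | alternating true t] :|:
                        [set t : k.-tuple X | alternating false t]| <= _).
  apply: subset_leq_card; apply/fintype.subsetP => _ /imsetP[t t_in ->].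
  move: t_in; rewrite !inE cycle_alternating size_tuple odd_double /= => /andP[alt_t _].
  have alt_take b m w : alternating b w -> alternating b (take m w).
    by elim: w b m => [|x w IHw] b [|m] //= /andP[-> /IHw->].
  by case/orP: alt_t => /alt_take->; rewrite ?orbT.
rewrite (leq_trans (leq_card_setU _ _).1) // mul2n -addnn leq_add //; exact: card_alternating_le.
Qed.

(** Both orbit estimates at length [2 k], halved; the error comes from fewer than [2 k] proper
    rotations, each fixing at most [2 * N ^ k./2.+1] words, weighted by [2 k]. *)
Lemma necklace_reps_bounds k : 0 < N -> 0 < k ->
  N ^ k <= k * #|necklace_reps k.*2| <= N ^ k + 4 * k ^ 2 * N ^ k./2.+1.
Proof.
move=> N_gt0 k_gt0; set c := #|_|.
have lower : k.*2 * c >= 2 * N ^ k.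
  by rewrite -card_necklaces_double // card_necklaces_le // double_gt0.
have upper : k.*2 * c <= 2 * N ^ k + k.*2 * (k.*2 * (2 * N ^ k./2.+1)).
  apply: leq_trans (card_necklaces_ge _) _; rewrite card_necklaces_double // leq_add2l leq_mul //.
  apply: leq_trans (_ : \sum_(i < k.*2) 2 * N ^ k./2.+1 <= _); last by rewrite sum_nat_const card_ord.
  rewrite [leqLHS]big_mkcond; apply: leq_sum => i _; case: ifP => // i_gt0.
  by rewrite card_rot_fixed ?i_gt0 /=.
move: lower upper; rewrite -!mul2n; set M := N ^ k./2.+1; set Q := N ^ k.
rewrite -mulnA leq_pmul2l // => -> /=.
have -> : 2 * Q + 2 * k * (2 * k * (2 * M)) = 2 * (Q + 4 * k ^ 2 * M) by rewrite -mulnn; ring.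
by rewrite leq_pmul2l.
Qed.

End Necklaces.

(** * Normal forms and conjugacy in the free product *)

Section FreeProductConjugacy.

Variables A B : groupType.

Local Open Scope group_scope.

Implicit Types (x y : A + B) (s t u w : seq (A + B)) (g : free_product A B).

Definition fp_eval s : free_product A B := \prod_(x <- s) fp_of_letter x.

Definition fp_word_inv s := rev (map (@fp_letterV A B) s).

Lemma fp_eval_cat s t : fp_eval (s ++ t) = fp_eval s * fp_eval t.
Proof. exact: big_cat. Qed.

Lemma fp_eval_word g : fp_eval (fp_word g) = g.
Proof. exact: esym (fp_prod_letters g). Qed.

Lemma fp_word_eval s : fp_word (fp_eval s) = foldr (@fp_cons A B) [::] s.
Proof.
rewrite /fp_eval; elim: s => [|x s IHs]; first by rewrite big_nil.
by rewrite big_cons [LHS]fp_of_letterM IHs.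
Qed.

Lemma fp_word_eval_id s : fp_normal s -> fp_word (fp_eval s) = s.
Proof.
rewrite fp_word_eval; elim: s => //= x s IHs nxs; rewrite IHs ?fp_consE //.
by move: nxs; rewrite fp_normal_cons => /and3P[].
Qed.

Lemma size_fp_cons x s : size (fp_cons x s) <= (size s).+1 ?= iff (fp_cons x s == x :: s).
Proof.
apply/leqifP; case: eqP => [-> //|neq].
by case: x s neq => [a|b] [|[a'|b'] s] /=; rewrite /fp_push; case: ifP.
Qed.

Lemma size_fp_eval s : size (fp_word (fp_eval s)) <= size s.
Proof.
rewrite fp_word_eval; elim: s => //= x s IHs.
by rewrite (leq_trans (size_fp_cons _ _).1).
Qed.

(** A letter lengthens the normal form by at most one, and by exactly one only when it is put in
    front unchanged; so if no length is lost, nothing was reduced. *)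
Lemma fp_eval_tight s : size s <= size (fp_word (fp_eval s)) -> fp_normal s.
Proof.
rewrite fp_word_eval; elim: s => //= x s IHs le_s.
have le_cons := (size_fp_cons x (foldr (@fp_cons A B) [::] s)).1.
have nf_s : size (foldr (@fp_cons A B) [::] s) = size s.
  have le_nf : size s <= size (foldr (@fp_cons A B) [::] s).
    by rewrite -ltnS (leq_trans le_s le_cons).
  by apply/eqP; rewrite eqn_leq le_nf andbT -fp_word_eval size_fp_eval.
have ns : fp_normal s by rewrite IHs ?nf_s.
have := (size_fp_cons x (foldr (@fp_cons A B) [::] s)).2.
rewrite -fp_word_eval fp_word_eval_id // in le_s le_cons *.
rewrite eqn_leq le_cons le_s => /esym/eqP <-.
exact: fp_cons_normal.
Qed.

Lemma fp_of_letterV x : fp_of_letter (fp_letterV x) = (fp_of_letter x)^-1.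
Proof.
apply: (mulgI (fp_of_letter x)); rewrite mulgV; case: x => c; rewrite /=.
  by rewrite -fp_inlM mulgV; apply: val_inj; rewrite /= /fp_push /= eqxx.
by rewrite -fp_inrM mulgV; apply: val_inj; rewrite /= /fp_push /= eqxx.
Qed.

Lemma fp_eval_inv s : fp_eval (fp_word_inv s) = (fp_eval s)^-1.
Proof.
rewrite /fp_eval /fp_word_inv; elim: s => [|x s IHs]; first by rewrite !big_nil invg1.
by rewrite rev_cons -cats1 big_cat big_seq1 IHs big_cons invgM fp_of_letterV.
Qed.

Lemma fp_alternateVl x y : fp_alternate (fp_letterV x) y = fp_alternate x y.
Proof. by case: x. Qed.

Lemma fp_alternate_or x y z : fp_alternate x y -> fp_alternate x z || fp_alternate y z.
Proof. by case: x y z => [a|b] [a'|b'] []. Qed.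

Lemma fp_word_invK : involutive fp_word_inv.
Proof.
move=> s; rewrite /fp_word_inv map_rev revK -map_comp.
by apply: map_id_in => -[a|b] _ /=; rewrite invgK.
Qed.

Lemma fp_word_inv_rot i s : exists j, fp_word_inv (rot i s) = rot j (fp_word_inv s).
Proof.
exists (size s - i); rewrite /fp_word_inv map_rot rev_rot /rotr size_rev size_map.
by [].
Qed.

Lemma fp_normal_cat s t : fp_normal s -> fp_normal t ->
  (forall x y, fp_alternate (last x s) (head y t)) -> fp_normal (s ++ t).
Proof.
case: s => // x s; case: t => [|y t]; first by rewrite cats0.
rewrite /fp_normal /= all_cat cat_path => /andP[/andP[-> ->] ->] /andP[/= -> ->].
by move/(_ x y) => /= ->.
Qed.

(** Copies of [w] are stripped from the front of [g] until [g] is no longer than [w]; then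
    [w = g ++ d] and [u = d ++ g] for some [d]. *)
Lemma rot_of_conj_words (T : eqType) (w g u : seq T) :
  w ++ g = g ++ u -> exists i, u = rot i w.
Proof.
case: w => [|x w] Ewg.
  exists 0; rewrite rot0; apply/nilP; rewrite /nilp.
  by move/(congr1 size): Ewg; rewrite /= size_cat -[LHS]addn0 => /addnI <-.
have [n] := ubnP (size g); elim: n g Ewg => // n IHn g Ewg lt_gn.
have [le_gw|lt_wg] := leqP (size g) (size (x :: w)).
  exists (size g); rewrite /rot.
  have := congr1 (take (size g)) Ewg; rewrite takel_cat // take_size_cat // => ->.
  have := congr1 (drop (size g)) Ewg; rewrite drop_cat drop_size_cat //.
  case: ltnP => // ge_gw; rewrite (eqP (_ : size g == size (x :: w))) ?eqn_leq ?le_gw //.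
  by rewrite subnn drop0 drop_size.
have Dg : g = (x :: w) ++ drop (size (x :: w)) g.
  rewrite -{1}[g](cat_take_drop (size (x :: w))); congr (_ ++ _).
  by have := congr1 (take (size (x :: w))) Ewg; rewrite take_size_cat // takel_cat // ltnW.
apply: (IHn (drop (size (x :: w)) g)).
  move: Dg; set d := drop _ _ => Dg.
  have := congr1 (drop (size (x :: w))) Ewg.
  by rewrite {2}Dg -catA !drop_size_cat // => <-; rewrite -Dg.
rewrite size_drop /=; rewrite /= in lt_wg; lia.
Qed.

(* The end letters of [w] lie in different factors, so one of [w ++ g] and
   [w^-1 ++ g] is reduced. *)
Lemma fp_conj_rot w u g : w != [::] -> all (@fp_nontriv A B) w ->
  path.cycle (@fp_alternate A B) w -> size u <= size w ->
  fp_eval w * g = g * fp_eval u -> exists i, u = rot i w.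
Proof.
move=> w_nz nt_w cyc_w le_uw Ewg.
have nw : fp_normal w.
  by rewrite /fp_normal nt_w; case: (w) cyc_w => //= x s; rewrite rcons_path => /andP[].
(* The normal word [s ++ fp_word g] has the same value as [fp_word g ++ t], which is no longer. The
   latter is therefore normal by [fp_eval_tight], and the two words coincide. *)
have main s t : size t <= size s -> fp_normal (s ++ fp_word g) ->
    fp_eval s * g = g * fp_eval t -> exists i, t = rot i s.
  move=> le_ts nsg; rewrite -{1 2}[g]fp_eval_word -!fp_eval_cat => Esg.
  apply: (@rot_of_conj_words _ _ (fp_word g)); rewrite -(fp_word_eval_id nsg) Esg.
  rewrite fp_word_eval_id // fp_eval_tight // -Esg fp_word_eval_id // !size_cat.
  by rewrite addnC leq_add2r.
case: w w_nz nt_w cyc_w le_uw Ewg nw => // x w _ nt_w cyc_w le_uw Ewg nw.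
have alt_lx : fp_alternate (last x w) x by move: cyc_w => /=; rewrite rcons_path => /andP[].
case Dg: (fp_word g) (fp_wordP g) => [|z v] nv; first by apply: main => //; rewrite Dg cats0.
have /orP[alt_lz|alt_xz] := fp_alternate_or z alt_lx.
  by apply: main => //; rewrite Dg; apply: fp_normal_cat.
have [|||i Du] := main (fp_word_inv (x :: w)) (fp_word_inv u).
- by rewrite /fp_word_inv !size_rev !size_map.
- rewrite Dg; apply: fp_normal_cat => //; first exact: fp_inv_normal.
  by move=> y1 y2; rewrite /fp_word_inv /= rev_cons last_rcons fp_alternateVl.
- by rewrite !fp_eval_inv; apply: (mulgI (fp_eval (x :: w))); rewrite mulVKg mulgA Ewg mulgK.
have [j Dj] := fp_word_inv_rot i (fp_word_inv (x :: w)).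
by exists j; rewrite -[LHS]fp_word_invK Du Dj fp_word_invK.
Qed.

End FreeProductConjugacy.

(** * The conjugacy language in terms of least rotations *)

Section ConjugacyLanguage.

Variables A B : finGroupType.

Local Open Scope group_scope.

Implicit Types (x y : fp_gens A B) (u w : seq (fp_gens A B)).

(** The normal form of a generator has exactly one letter, which [head] extracts. *)
Definition letter x : A + B := head (inl 1) (fp_word (val x)).

Lemma fp_word_of_letter (l : A + B) : fp_nontriv l -> fp_word (fp_of_letter l) = [:: l].
Proof. by case: l => c /= ntc; rewrite /fp_push /= ntc. Qed.

Lemma letterP x : fp_nontriv (letter x) /\ val x = fp_of_letter (letter x).
Proof.
have [l ntl Dx] : exists2 l, fp_nontriv l & val x = fp_of_letter l.
  have := valP x; rewrite in_fsetU => /orP[] /imfsetP[c /= ntc ->].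
    by exists (inl c) => //; move: ntc; rewrite !inE andbT.
  by exists (inr c) => //; move: ntc; rewrite !inE andbT.
by rewrite /letter Dx fp_word_of_letter.
Qed.

Lemma letter_inj : injective letter.
Proof. by move=> x y eq_xy; apply: val_inj; rewrite !(letterP _).2 eq_xy. Qed.

Lemma letter_surj (l : A + B) : fp_nontriv l -> exists x, letter x = l.
Proof.
move=> ntl.
have gl : fp_of_letter l \in fp_gens A B.
  rewrite in_fsetU; case: l ntl => c ntc; apply/orP; [left|right];
    by apply/imfsetP; exists c => //=; rewrite !inE andbT.
by exists [` gl]%fset; rewrite /letter /= fp_word_of_letter.
Qed.

Lemma letters_surj (s : seq (A + B)) : all (@fp_nontriv A B) s -> exists w, map letter w = s.
Proof.
elim: s => [|l s IHs] /=; first by exists [::].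
by case/andP=> /letter_surj[x <-] /IHs[w <-]; exists (x :: w).
Qed.

Lemma all_fp_nontriv_letters w : all (@fp_nontriv A B) (map letter w).
Proof. by rewrite all_map; apply/allP => x _; apply: (letterP x).1. Qed.

Lemma word_eval_letters w : word_eval w = fp_eval (map letter w).
Proof. by rewrite /word_eval /fp_eval big_map; apply: eq_bigr => x _; apply: (letterP x).2. Qed.

Definition in_left x := if letter x is inl _ then true else false.

Lemma switch_letter x y : fp_alternate (letter x) (letter y) = switch in_left x y.
Proof. by rewrite /switch /in_left; case: (letter x) (letter y) => [a|b] []. Qed.

Lemma cycle_letters w :
  path.cycle (@fp_alternate A B) (map letter w) = path.cycle (switch in_left) w.
Proof. by rewrite cycle_map; apply: eq_cycle => x y /=; apply: switch_letter. Qed.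

Lemma word_eval_rot i w : word_eval (rot i w) = word_eval w ^ word_eval (take i w).
Proof.
rewrite -{2}(cat_take_drop i w) /word_eval /rot !big_cat /= conjgE.
by rewrite -mulgA mulKg.
Qed.

(** Rotating conjugates the value, so a least word is least among its rotations. Conversely, by
    [fp_conj_rot], all words of the class no longer than a cyclically alternating [w] are rotations
    of [w]. A single letter does not alternate with itself, whence the bound on the size. *)
Lemma spherical_conj_languageE (lt : rel (fp_gens A B)) w : 1 < size w ->
  spherical_conj_language lt w <->
  path.cycle (switch in_left) w /\ least_rotation (lex_lt lt) w.
Proof.
move=> gt1_w; split=> [[_ [g ->] [[k Dw] min_w]]|[cyc_w /least_rotationP least_w]].
  have {}min_w u h : word_eval u = word_eval w ^ h -> u = w \/ shortlex lt w u.
    by move=> Du; apply: min_w; exists (k * h); rewrite Du Dw conjgM.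
  (* Otherwise the normal form of the value of [v] spells a shorter word of the class. *)
  have normal_conj v : size v = size w -> (exists h, word_eval v = word_eval w ^ h) ->
      fp_normal (map letter v).
    move=> sz_v [h Dv]; apply: fp_eval_tight; rewrite leqNgt; apply/negP => lt_v.
    have /andP[nt_v _] := fp_wordP (fp_eval (map letter v)).
    have [u Du] := letters_surj nt_v.
    rewrite size_map sz_v -Du size_map in lt_v.
    have [||] := min_w u h.
    - by rewrite word_eval_letters Du fp_eval_word -word_eval_letters.
    - by move=> Duw; rewrite Duw ltnn in lt_v.
    - by rewrite /shortlex ltnNge (ltnW lt_v) gtn_eqF.
  split.
    have /andP[_] : fp_normal (map letter w) by apply: normal_conj => //; exists 1; rewrite conjg1.
    (* Normality of [rot 1 w] gives alternation from the last letter of [w] to the first. *)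
    have /andP[_] : fp_normal (map letter (rot 1 w)).
      by apply: normal_conj; rewrite ?size_rot //; eexists; apply: word_eval_rot.
    rewrite -cycle_letters; case: w gt1_w {min_w normal_conj Dw} => [|x [|y w]] // _.
    by rewrite map_rot rot1_cons /= => -> /andP[-> _].
  apply/least_rotationP => i; have [->|] := min_w _ _ (word_eval_rot i w); first by rewrite eqxx.
  by rewrite /shortlex size_rot ltnn eqxx /= => ->; rewrite orbT.
exists (conj_class (word_eval w)); first by exists (word_eval w).
split; first by exists 1; rewrite conjg1.
move=> u [k Du]; have [lt_wu|le_uw] := ltnP (size w) (size u).
  by right; rewrite /shortlex lt_wu.
have [|||||i] := @fp_conj_rot A B (map letter w) (map letter u) k.
- by rewrite -size_eq0 size_map -lt0n ltnW.
- exact: all_fp_nontriv_letters.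
- by rewrite cycle_letters.
- by rewrite !size_map.
- by rewrite -!word_eval_letters Du conjgE mulKVg.
rewrite -map_rot => /(inj_map letter_inj) ->.
have /orP[/eqP->|lt_w] := least_w i; first by left.
by right; rewrite /shortlex size_rot ltnn eqxx.
Qed.

End ConjugacyLanguage.

(** * Regular languages have rational growth *)

Section Regular.

Import GRing.Theory.

Local Open Scope ring_scope.

(** The denominator is the characteristic polynomial reversed, so its constant term is [u k]; the
    numerator has degree below [k], as the recurrence kills all later coefficients. *)
Lemma recurrence_rational (F : fieldType) (a u : nat -> F) (k : nat) : u k != 0 ->
  (forall n, \sum_(i < k.+1) u i * a (n + i)%N = 0) -> rational_series a.
Proof.
move=> uk rec_a.
pose q : {poly F} := \poly_(i < k.+1) u (k - i)%N.
pose p : {poly F} := \poly_(n < k) \sum_(i < n.+1) q`_i * a (n - i)%N.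
exists p, q; split; first by rewrite coef_poly subn0.
move=> n; rewrite [RHS]coef_poly; case: ltnP => // le_kn.
rewrite -[RHS](rec_a (n - k)%N).
rewrite (big_ord_widen n.+1 (fun i => u i * a (n - k + i)%N)) // [RHS]big_mkcond /=.
have -> : \sum_(i < n.+1) q`_i * a (n - i)%N =
    \sum_(i < n.+1) if (i < k.+1)%N then u (k - i)%N * a (n - i)%N else 0.
  by apply: eq_bigr => i _; rewrite coef_poly; case: ifP; rewrite ?mul0r.
rewrite -!big_mkcond /=.
rewrite -(big_ord_widen n.+1 (fun i => u (k - i)%N * a (n - i)%N)) //.
rewrite -(big_ord_widen n.+1 (fun i => u i * a (n - k + i)%N)) //.
rewrite [LHS](reindex_inj rev_ord_inj) /=; apply: eq_bigr => i _.
have le_ik : (i <= k)%N by rewrite -ltnS.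
by congr (u _ * a _); lia.
Qed.

(** The vector of acceptance counts, indexed by states, evolves linearly with the length. A linear
    dependence among its first values therefore persists under shifts and is a recurrence. *)
Lemma regular_growth_rational (F : fieldType) (T : finType) (L : classical_sets.set (seq T)) :
  regular L -> rational_series (fun n => (growth L n)%:R : F).
Proof.
case=> M acc_M.
pose f s n := #|[pred t : n.-tuple T | final (foldl (@step _ M) s t)]|.
have f_step s n : f s n.+1 = (\sum_x f (step s x) n)%N.
  rewrite /f -sum1_card (reindex (fun p : T * n.-tuple T => [tuple of p.1 :: p.2])) /=; last first.
    exists (fun t => (thead t, [tuple of behead t])) => [[x t] _|t _] /=.
      by rewrite theadE; congr (_, _); apply: val_inj.
    by case/tupleP: t => x t; rewrite theadE; apply: val_inj.
  rewrite -(pair_big_dep xpredT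
    (fun x t => final (foldl (@step _ M) (step s x) (tval t))) (fun _ _ => 1%N)) /=.
  by apply: eq_bigr => x _; rewrite sum1_card.
pose S := #|state M|.
(* One row per length and one more row than columns, so the rows are dependent. *)
pose V : 'M[F]_(S.+1, S) := \matrix_(i, j) (f (enum_val j) i)%:R.
have [u u_nz uV] : exists2 u : 'rV[F]_S.+1, u != 0 & u *m V = 0.
  exists (nz_row (kermx V)); last by apply/sub_kermxP/nz_row_sub.
  rewrite nz_row_eq0 -mxrank_eq0 mxrank_ker -lt0n subn_gt0.
  exact: leq_ltn_trans (rank_leq_col V) _.
pose c i : F := if insub i is Some j then u 0 j else 0.
have cE (j : 'I_S.+1) : c j = u 0 j by rewrite /c valK.
have rel_c s n : \sum_(i < S.+1) c i * (f s (n + i)%N)%:R = 0.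
  elim: n s => [|n IHn] s.
    move/matrixP/(_ 0 (enum_rank s)): uV; rewrite !mxE => uV; rewrite -[RHS]uV.
    by apply: eq_bigr => i _; rewrite !mxE enum_rankK cE.
  transitivity (\sum_x \sum_(i < S.+1) c i * (f (step s x) (n + i)%N)%:R).
    rewrite exchange_big; apply: eq_bigr => i _.
    by rewrite addSn f_step natr_sum mulr_sumr.
  by rewrite big1.
have [j0 uj0] : exists j, u 0 j != 0.
  apply/existsP; apply: contraNT u_nz => /existsPn u0.
  by apply/eqP/rowP => j; rewrite mxE; apply/eqP/negPn.
(* The last nonzero coefficient serves as the leading one. *)
pose k : 'I_S.+1 := [arg max_(i > j0 | u 0 i != 0) i].
have [ck max_k] : c k != 0 /\ forall i : 'I_S.+1, (k < i)%N -> c i = 0.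
  rewrite /k; case: arg_maxnP => // i ui max_i; split=> [|j lt_ij]; rewrite cE //.
  by apply/eqP; apply: contraTT lt_ij => /max_i; rewrite -leqNgt.
apply: (recurrence_rational ck) => n.
have growthE m : growth L m = f (initial M) m.
  by apply: eq_card => t; rewrite !inE; apply/asboolP/idP => /acc_M.
rewrite -[RHS](rel_c (initial M) n).
rewrite (big_ord_widen S.+1 (fun i => c i * (growth L (n + i))%:R)) // [LHS]big_mkcond /=.
apply: eq_bigr => i _; rewrite growthE; case: ltnP => // lt_ki.
by rewrite max_k ?mul0r.
Qed.

End Regular.

(** * Orders of the factors and coefficients of the growth series *)

Section GrowthFreeProduct.

Variables A B : finGroupType.

Local Open Scope group_scope.

Lemma isog_Z2 (C : finGroupType) : [set: C] \isog [set: 'Z_2] <-> #|C| = 2.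
Proof.
have cardZ2 : #|[set: 'Z_2]| = 2 by rewrite cardsT card_ord.
split=> [/card_isog|cardC]; first by rewrite cardZ2 cardsT.
by rewrite isog_cyclic_card ?prime_cyclic ?cardZ2 ?cardsT ?cardC.
Qed.

Lemma in_leftP (x : fp_gens A B) :
  if in_left x then val x \in gens_left A B else val x \in gens_right A B.
Proof.
have [ntx ->] := letterP x; rewrite /in_left.
by case: (letter x) ntx => c ntc; apply/imfsetP; exists c; rewrite //= !inE andbT.
Qed.

Lemma card_in_left : #|[pred x : fp_gens A B | in_left x]| = #|A|.-1.
Proof.
have -> : #|[pred x : fp_gens A B | in_left x]| = #|[set x : fp_gens A B | in_left x]|.
  by apply: eq_card => x; rewrite !inE.
have -> : #|A|.-1 = #|[set: A]^#| by rewrite -cardsT (cardsD1 1 [set: A]) inE.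
rewrite -(card_imset _ (@letter_inj A B)) -[RHS](card_imset _ (@inl_inj A B)).
apply: eq_card => l; apply/imsetP/imsetP => [[x]|[a]].
  rewrite inE /in_left; have [] := letterP x; case: (letter x) => // a nta _ _ ->.
  by exists a; rewrite // !inE andbT.
rewrite !inE andbT => nta ->; have [x Dx] := @letter_surj A B (inl a) nta.
by exists x; rewrite // inE /in_left Dx.
Qed.

Lemma card_in_right : #|[pred x : fp_gens A B | ~~ in_left x]| = #|B|.-1.
Proof.
have -> : #|[pred x : fp_gens A B | ~~ in_left x]| = #|[set x : fp_gens A B | ~~ in_left x]|.
  by apply: eq_card => x; rewrite !inE.
have -> : #|B|.-1 = #|[set: B]^#| by rewrite -cardsT (cardsD1 1 [set: B]) inE.
rewrite -(card_imset _ (@letter_inj A B)) -[RHS](card_imset _ (@inr_inj A B)).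
apply: eq_card => l; apply/imsetP/imsetP => [[x]|[b]].
  rewrite inE /in_left; have [] := letterP x; case: (letter x) => // b ntb _ _ ->.
  by exists b; rewrite // !inE andbT.
rewrite !inE andbT => ntb ->; have [x Dx] := @letter_surj A B (inr b) ntb.
by exists x; rewrite // inE /in_left Dx.
Qed.

Variable lt : rel (fp_gens A B).

Lemma growth_necklace_reps n : 1 < n ->
  growth (spherical_conj_language lt) n = #|necklace_reps (@in_left A B) (lex_lt lt) n|.
Proof.
move=> n_gt1; apply: eq_card => t; rewrite !inE.
have sz_t : 1 < size t by rewrite size_tuple.
apply/asboolP/andP; by case: (spherical_conj_languageE lt sz_t).
Qed.

End GrowthFreeProduct.

(** * At most one letter of each type *)

Section TwoLetters.

Variables (X : finType) (ty : pred X).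
Hypothesis ty_inj : injective ty.

Lemma alternating_inj (b : bool) (v w : seq X) :
  alternating ty b v -> alternating ty b w -> size v = size w -> v = w.
Proof.
elim: v w b => [|x v IHv] [|y w] //= b /andP[/eqP Dx alt_v] /andP[/eqP Dy alt_w] [sz_v].
by rewrite (IHv w (~~ b)) //; congr (_ :: _); apply: ty_inj; rewrite Dx.
Qed.

Lemma alternating_rot1 (b : bool) (w : seq X) : path.cycle (switch ty) w ->
  alternating ty b w -> alternating ty (~~ b) (rot 1 w).
Proof.
case: w => [|x [|y w]] // cyc_w; first by rewrite /= /switch eqxx in cyc_w.
have := cyc_w; rewrite -(rot_cycle 1) cycle_alternating => /andP[_].
rewrite rot1_cons /= => alt_r /and3P[_ /eqP ty_y _].
by rewrite ty_y in alt_r *; case: (b) alt_r; rewrite /= ?orbF.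
Qed.

(** The first type and the length determine an alternating word, and [rot 1] exchanges the two
    types. *)
Lemma necklace_two_letters (v w : seq X) :
    path.cycle (switch ty) v -> path.cycle (switch ty) w -> size v = size w -> v = w \/ v = rot 1 w.
Proof.
move=> cyc_v cyc_w eq_sz.
have [b alt_v] : exists b, alternating ty b v.
  by move: cyc_v; rewrite cycle_alternating => /andP[_ /orP[]]; [exists true | exists false].
have [c alt_w] : exists c, alternating ty c w.
  by move: cyc_w; rewrite cycle_alternating => /andP[_ /orP[]]; [exists true | exists false].
have [eq_bc|neq_bc] := eqVneq b c.
  by left; apply: alternating_inj alt_v _ eq_sz; rewrite eq_bc.
right; apply: alternating_inj alt_v _ _; last by rewrite size_rot.
have -> : b = ~~ c by case: (b) (c) neq_bc => -[].
exact: alternating_rot1.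
Qed.

(** Existence is the lower bound of [necklace_reps_bounds] at [N = 1]; two representatives are
    rotations of each other, hence equal. *)
Lemma card_reps_two_letters (lex : rel (seq X)) k :
    irreflexive lex -> transitive lex ->
    (forall u v, size u = size v -> [|| u == v, lex u v | lex v u]) ->
    #|[pred x | ty x]| * #|[pred x | ~~ ty x]| = 1 -> 0 < k ->
  #|necklace_reps ty lex k.*2| = 1.
Proof.
move=> lex_irr lex_trans lex_total card_ty k_gt0; apply/eqP; rewrite eqn_leq.
have /(_ isT k_gt0) := necklace_reps_bounds lex_irr lex_trans lex_total card_ty (k := k).
rewrite exp1n muln_gt0 k_gt0 => /andP[/= -> _]; rewrite andbT; apply/card_le1_eqP => t u.
rewrite !inE => /andP[cyc_t least_t] /andP[cyc_u least_u].
apply: val_inj => /=; have [|//|Dt] := necklace_two_letters cyc_t cyc_u.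
  by rewrite !size_tuple.
by rewrite /= Dt; apply/esym/(least_rotation_unique lex_irr lex_trans); rewrite // -Dt.
Qed.

End TwoLetters.

(** * An automaton for alternating words of even length *)

Section Automaton.

Variables (X : finType) (ty : pred X) (L : classical_sets.set (seq X)).
Hypothesis L_alternating :
  forall w, 1 < size w -> L w <-> ~~ odd (size w) && alternating ty true w.

(* [None] is a sink and [Some None] the start; words with one letter are
   remembered, and [inr b] expects a letter of type [b] next. *)
Definition alternating_step (q : option (option (X + bool))) (x : X) : option (option (X + bool)) :=
  match q with
  | None => None
  | Some None => Some (Some (inl x))
  | Some (Some (inl y)) => if ty y && ~~ ty x then Some (Some (inr true)) else None
  | Some (Some (inr b)) => if ty x == b then Some (Some (inr (~~ b))) else None
  end.

(** Words with fewer than two letters are decided by membership in [L]; later, [inr true] marks even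
    length. *)
Definition alternating_final (q : option (option (X + bool))) : bool :=
  match q with
  | None => false
  | Some None => `[< L [::] >]
  | Some (Some (inl x)) => `[< L [:: x] >]
  | Some (Some (inr b)) => b
  end.

Lemma regular_alternating : regular L.
Proof.
exists (@Automaton X _ (Some None) alternating_step alternating_final) => w.
have runN v : foldl alternating_step None v = None by elim: v.
have runS b v : foldl alternating_step (Some (Some (inr b))) v =
    if alternating ty b v then Some (Some (inr (b (+) odd (size v)))) else None.
  elim: v b => [|x v IHv] b /=; first by rewrite addbF.
  by case: eqP => _ /=; rewrite ?runN // IHv addNb addbN.
case: w => [|x [|y w]]; first by split=> /asboolP.
  by split=> /asboolP.
rewrite L_alternating // /accepts /= eqb_id eqbF_neg.
case: (ty x) => /=; last by rewrite runN andbF.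
case: (ty y) => /=; first by rewrite runN andbF.
by rewrite runS negbK; case: ifP => _ /=; rewrite ?andbT ?andbF.
Qed.

End Automaton.

(** * The two equivalences *)

Section MainArgument.

Variables A B : finGroupType.

Lemma in_left_inj : #|A| = 2 -> #|B| = 2 -> injective (@in_left A B).
Proof.
move=> cardA cardB x y eq_xy.
have /card_le1_eqP injA : #|[pred x : fp_gens A B | in_left x]| <= 1.
  by rewrite card_in_left cardA.
have /card_le1_eqP injB : #|[pred x : fp_gens A B | ~~ in_left x]| <= 1.
  by rewrite card_in_right cardB.
case inx: (in_left x); first by apply: injA; rewrite inE -?eq_xy.
by apply: injB; rewrite inE -?eq_xy inx.
Qed.

Variable lt : rel (fp_gens A B).
Hypothesis lt_order : strict_total_order lt.

Let lex_irr := lex_lt_irr lt_order.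
Let lex_trans := lex_lt_trans lt_order.
Let lex_total := lex_lt_total lt_order.

Lemma dihedral_rational (F : fieldType) : #|A| = 2 -> #|B| = 2 ->
  rational_series (spherical_conj_growth_series F lt).
Proof.
move=> cardA cardB; rewrite /spherical_conj_growth_series.
have card_ty : #|[pred x : fp_gens A B | in_left x]| *
    #|[pred x : fp_gens A B | ~~ in_left x]| = 1.
  by rewrite card_in_left card_in_right cardA cardB.
(* The recurrence says that the coefficients at [n + 4] and [n + 2] agree; starting at 2 keeps to
   lengths described by necklaces. *)
pose u (i : nat) : F := if i == 4 then 1%R else if i == 2 then (- 1)%R else 0%R.
apply: (@recurrence_rational F _ u 4) => [|n]; first exact: GRing.oner_neq0.
rewrite !big_ord_recr big_ord0 /= /u /= !GRing.mul0r !GRing.addr0 !GRing.add0r.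
rewrite GRing.mulN1r GRing.mul1r.
suff -> : growth (spherical_conj_language lt) (n + 4) =
    growth (spherical_conj_language lt) (n + 2).
  by rewrite GRing.addNr.
rewrite !growth_necklace_reps ?addn4 ?addn2 //.
have [odd_n|even_n] := boolP (odd n); first by rewrite !card_necklace_reps_odd //= ?negbK.
have := odd_double_half n; rewrite (negPf even_n) add0n => <-.
rewrite -!doubleS !(card_reps_two_letters _ lex_irr lex_trans lex_total) //; exact: in_left_inj.
Qed.

Lemma rational_dihedral (F : numFieldType) : 1 < #|A| -> 1 < #|B| ->
  rational_series (spherical_conj_growth_series F lt) -> #|A| = 2 /\ #|B| = 2.
Proof.
move=> cardA cardB rat_f; pose N := #|A|.-1 * #|B|.-1.
have N_gt0 : 0 < N by rewrite muln_gt0; lia.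
(* As both orders exceed 1, [N = 1] only when both are 2. *)
have [N_gt1|N_le1] := ltnP 1 N; last first.
  have /eqP : N = 1 by lia.
  by rewrite muln_eq1 => /andP[/eqP cA /eqP cB]; lia.
have card_ty : #|[pred x : fp_gens A B | in_left x]| *
    #|[pred x : fp_gens A B | ~~ in_left x]| = N.
  by rewrite card_in_left card_in_right.
case: (irrational_growth N_gt1 _ _ rat_f) => [k k_gt0|n odd_n n_gt2].
  rewrite growth_necklace_reps //; last by rewrite -addnn; lia.
  exact: (necklace_reps_bounds lex_irr lex_trans lex_total card_ty).
by rewrite growth_necklace_reps ?card_necklace_reps_odd // ltnW.
Qed.

(** Left letters come first in the order, so of the two alternating words of a given even length the
    one starting on the left is the least rotation. *)
Lemma dihedral_regular : #|A| = 2 -> #|B| = 2 ->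
    (forall x y : fp_gens A B,
       val x \in gens_left A B -> val y \in gens_right A B -> lt x y) ->
  regular (spherical_conj_language lt).
Proof.
move=> cardA cardB lt_LR; have left_inj := in_left_inj cardA cardB.
apply: (@regular_alternating _ (@in_left A B)) => w gt1_w.
have lt_left x y : in_left x -> ~~ in_left y -> lt x y.
  move=> inx iny; apply: lt_LR; first by have := in_leftP x; rewrite inx.
  by have := in_leftP y; rewrite (negPf iny).
have lex_left u v : alternating (@in_left A B) true u -> alternating (@in_left A B) false v ->
    size u = size v -> 1 < size u -> lex_lt lt u v.
  case: u v => [|x u] [|y v] //= /andP[/eqP inx _] /andP[/eqP iny _] _ _.
  by rewrite lt_left ?inx ?iny.
rewrite (spherical_conj_languageE lt gt1_w) cycle_alternating.
split=> [[/andP[even_w /orP[alt_w|alt_w]] least_w]|/andP[even_w alt_w]].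
- by rewrite even_w.
- have cyc_w : path.cycle (switch (@in_left A B)) w by rewrite cycle_alternating even_w alt_w orbT.
  (* Rotating by one brings a left letter to the front. *)
  have lt_rw : lex_lt lt (rot 1 w) w.
    by apply: lex_left; rewrite ?size_rot //; apply: (alternating_rot1 cyc_w alt_w).
  have /orP[/eqP Dw|gt_rw] := least_rotationP _ _ least_w 1; first by rewrite Dw lex_irr in lt_rw.
  by have := lex_trans lt_rw gt_rw; rewrite lex_irr.
split; first by rewrite even_w alt_w.
apply/least_rotationP => i.
have cyc_w : path.cycle (switch (@in_left A B)) w by rewrite cycle_alternating even_w alt_w.
have cyc_rw : path.cycle (switch (@in_left A B)) (rot i w) by rewrite rot_cycle.
have [|->|->] := necklace_two_letters left_inj cyc_rw cyc_w; rewrite ?size_rot ?eqxx //.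
by rewrite lex_left ?orbT ?size_rot //; apply: (alternating_rot1 cyc_w alt_w).
Qed.

End MainArgument.

Lemma card_gt1_nontrivial (C : finGroupType) : [set: C] != [1 C]%g -> 1 < #|C|.
Proof. by move=> ntC; rewrite -cardsT cardG_gt1. Qed.

Theorem theorem2p4 (F : numFieldType) (A B : finGroupType)
    (ntA : [set: A] != [1 A]%g) (ntB : [set: B] != [1 B]%g) :
  (forall lt : rel (fp_gens A B), strict_total_order lt ->
     rational_series (spherical_conj_growth_series F lt) <->
     [set: A] \isog [set: 'Z_2] /\ [set: B] \isog [set: 'Z_2]) /\
  (forall lt : rel (fp_gens A B), strict_total_order lt ->
     (forall x y : fp_gens A B,
        val x \in gens_left A B -> val y \in gens_right A B -> lt x y) ->
     regular (spherical_conj_language lt) <->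
     [set: A] \isog [set: 'Z_2] /\ [set: B] \isog [set: 'Z_2]).
Proof.
have cardA := card_gt1_nontrivial ntA; have cardB := card_gt1_nontrivial ntB.
have rationalE (lt : rel (fp_gens A B)) : strict_total_order lt ->
    rational_series (spherical_conj_growth_series F lt) <->
    [set: A] \isog [set: 'Z_2] /\ [set: B] \isog [set: 'Z_2].
  move=> lt_order; rewrite !isog_Z2; split; first exact: rational_dihedral.
  by case; apply: dihedral_rational.
split=> // lt lt_order lt_LR; split=> [reg_L|]; last first.
  by rewrite !isog_Z2; case=> cA cB; apply: dihedral_regular.
(* Regularity makes the growth rational, which reduces to the first equivalence. *)
exact/(rationalE lt lt_order)/regular_growth_rational.
Qed.
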